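(* Let $G=\langle a,b,c,s,t\mid c=ab=ba,\ c^2=sas^{-1}=tbt^{-1}\rangle$ and let $\ell$ be the word length on $G$ with respect to the generators $a,b,c,s,t$. Then $G$ has polynomial branching relative to $\ell$.
   Context: Let $\Gamma$ be a countable group with a length function $|\cdot|$. A 3-path from the identity $e$ to $z\in\Gamma$ is a triple $(a_3,a_2,a_1)\in\Gamma^3$ with $z=a_3a_2a_1$. Given $\kappa\ge1$, $\delta\ge 0$, it is $(\kappa,\delta)$-geodesic if $|a_1|+|a_2|+|a_3|\le \kappa|a_3a_2a_1|+\delta$. A triangle of $\Gamma$ is a triple $(x,y,z)\in\Gamma^3$ with $yx=z$. A family $C=(C_z^r)_{z\in\Gamma,\,r\in\mathbb{R}_+}$, where $C_z^r$ is a set of 3-paths from $e$ to $z$, has polynomial growth if there is a polynomial $p_1$ such that $\#C_z^r\le p_1(r)$ for all $r\in\mathbb{R}_+$, $z\in\Gamma$. Let $\mathfrak{s},\mathfrak{s}^-$ be sets of triangles of $\Gamma$ and $C$ such a family of 3-paths. For $(u,v,w)\in\mathfrak{s}^-$ and $r\in\mathbb{R}_+$, let $D^r_{(u,v,w)}$ be the set of triples $(a,b,c)\in\Gamma^3$ such that $(b^{-1},u,a)\in C^r_{b^{-1}ua}$, $(c^{-1},v,b)\in C^r_{c^{-1}vb}$ and $(c^{-1},w,a)\in C^r_{c^{-1}wa}$. One says that $\mathfrak{s}^-$ is a retract of $\mathfrak{s}$ along $C$ if there is a polynomial $p_2$ such that for every $(x,y,z)\in\mathfrak{s}$ there exist $(u,v,w)\in\mathfrak{s}^-$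 with $|u|\le p_2(|x|)$ and $(a,b,c)\in D^{|x|}_{(u,v,w)}$ such that $b^{-1}ua=x$ and $c^{-1}wa=z$. A set $\mathfrak{s}$ of triangles has polynomial growth if there is a polynomial $p_3$ such that for all $z\in\Gamma$ and $r\in\mathbb{R}_+$ the number of triangles $(x,y,z)\in\mathfrak{s}$ with $|x|\le r$ is at most $p_3(r)$. $\Gamma$ has polynomial branching relative to $|\cdot|$ if there exist $\kappa\ge1$, $\delta\ge0$, a family $C=(C_z^r)$ of sets $C_z^r$ of $(\kappa,\delta)$-geodesic 3-paths from $e$ to $z$ which has polynomial growth, and a set $\mathfrak{s}$ of triangles of $\Gamma$ which is a retract along $C$ of the set of all triangles of $\Gamma$ and which has polynomial growth. *)

(* Defs.v *)
From HB Require Import structures.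
From mathcomp Require Import all_boot all_order all_algebra.
From mathcomp Require Import generic_quotient.
From mathcomp Require Import all_classical reals.

Set Implicit Arguments.
Unset Strict Implicit.
Unset Printing Implicit Defensive.

Import Order.TTheory GRing.Theory Num.Theory.

Local Open Scope classical_set_scope.
Local Open Scope ring_scope.
Local Open Scope quotient_scope.

(* Words in the letters x^{+-1}, for x in I: (x, false) stands for x and      *)
(* (x, true) for the inverse of x.                                            *)
Definition word (I : Type) := seq (I * bool).

Definition inv_word I (w : word I) : word I :=
  rev [seq (p.1, ~~ p.2) | p <- w].

Section PresentedGroup.
Variables (I : choiceType) (rels : seq (word I * word I)).

(* The congruence on words generated by x x^-1 = x^-1 x = 1 and by the        *)
(* relations u = v for (u, v) in rels.                                        *)
Inductive pres_eq : word I -> word I -> Prop :=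
| PresRefl u : pres_eq u u
| PresSym u v : pres_eq u v -> pres_eq v u
| PresTrans u v w : pres_eq u v -> pres_eq v w -> pres_eq u w
| PresCat u u' v v' : pres_eq u u' -> pres_eq v v' ->
    pres_eq (u ++ v) (u' ++ v')
| PresCancel x b : pres_eq [:: (x, b); (x, ~~ b)] [::]
| PresRel u v : (u, v) \in rels -> pres_eq u v.

Definition pres_eqb (u v : word I) : bool := `[< pres_eq u v >].

Fact pres_eqb_refl : reflexive pres_eqb.
Proof. by move=> u; apply/asboolP; apply: PresRefl. Qed.

Fact pres_eqb_sym : symmetric pres_eqb.
Proof. by move=> u v; apply/asboolP/asboolP; apply: PresSym. Qed.

Fact pres_eqb_trans : transitive pres_eqb.
Proof.
by move=> v u w /asboolP uv /asboolP vw; apply/asboolP; apply: PresTrans uv vw.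
Qed.

Canonical pres_equiv := EquivRel pres_eqb pres_eqb_refl pres_eqb_sym
  pres_eqb_trans.

Definition presented := {eq_quot pres_equiv}.
HB.instance Definition _ := Choice.on presented.
HB.instance Definition _ := EqQuotient.on presented.

Definition pres_class (w : word I) : presented := \pi_presented w.

Lemma pres_classP u v : pres_class u = pres_class v <-> pres_eq u v.
Proof.
split=> [/eqP|uv]; first by rewrite eqmodE => /asboolP.
by apply/eqP; rewrite eqmodE; apply/asboolP.
Qed.

Lemma pres_reprK (g : presented) : pres_class (repr g) = g.
Proof. exact: reprK. Qed.

Lemma pres_eq_catV w : pres_eq (w ++ inv_word w) [::].
Proof.
elim: w => [|[x b] w IH]; first exact: PresRefl.
rewrite /inv_word /= rev_cons -cats1 -/(inv_word w).
apply: PresTrans (PresCancel x b).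
apply: (PresCat (PresRefl [:: (x, b)])).
by rewrite catA; apply: (PresCat IH); apply: PresRefl.
Qed.

Lemma inv_wordK : involutive (@inv_word I).
Proof.
move=> w; rewrite /inv_word map_rev revK -map_comp -[RHS]map_id.
by apply: eq_map => -[x b] /=; rewrite negbK.
Qed.

Lemma pres_eq_catVl w : pres_eq (inv_word w ++ w) [::].
Proof. by have := pres_eq_catV (inv_word w); rewrite inv_wordK. Qed.

Lemma pres_eq_inv u v : pres_eq u v -> pres_eq (inv_word u) (inv_word v).
Proof.
move=> uv; apply: (@PresTrans _ (inv_word u ++ (v ++ inv_word v))).
  rewrite -[X in pres_eq X _]cats0; apply: PresCat; first exact: PresRefl.
  exact/PresSym/pres_eq_catV.
rewrite catA -[X in pres_eq _ X]cat0s; apply: PresCat; last exact: PresRefl.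
apply: PresTrans (pres_eq_catVl u); apply: PresCat; first exact: PresRefl.
exact: PresSym.
Qed.

Definition pres_one : presented := pres_class [::].
Definition pres_mul (g h : presented) : presented :=
  pres_class (repr g ++ repr h).
Definition pres_inv (g : presented) : presented :=
  pres_class (inv_word (repr g)).

Lemma pres_eq_repr w : pres_eq (repr (pres_class w)) w.
Proof. exact/pres_classP/pres_reprK. Qed.

Lemma pres_class_cat u v :
  pres_class (u ++ v) = pres_mul (pres_class u) (pres_class v).
Proof. by apply/pres_classP/PresCat; apply/PresSym/pres_eq_repr. Qed.

Lemma pres_class_inv w : pres_class (inv_word w) = pres_inv (pres_class w).
Proof. by apply/pres_classP/pres_eq_inv/PresSym/pres_eq_repr. Qed.

Fact pres_mulA : associative pres_mul.
Proof.
move=> g h k; rewrite -(pres_reprK g) -(pres_reprK h) -(pres_reprK k).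
by rewrite -!pres_class_cat catA.
Qed.

Fact pres_mul1 : left_id pres_one pres_mul.
Proof. by move=> g; rewrite -(pres_reprK g) -pres_class_cat. Qed.

Fact pres_mulr1 : right_id pres_one pres_mul.
Proof. by move=> g; rewrite -(pres_reprK g) -pres_class_cat cats0. Qed.

Fact pres_mulV : left_inverse pres_one pres_inv pres_mul.
Proof.
move=> g; rewrite -(pres_reprK g) -pres_class_inv -pres_class_cat.
exact/pres_classP/pres_eq_catVl.
Qed.

Fact pres_mulrV : right_inverse pres_one pres_inv pres_mul.
Proof.
move=> g; rewrite -(pres_reprK g) -pres_class_inv -pres_class_cat.
exact/pres_classP/pres_eq_catV.
Qed.

HB.instance Definition _ := isGroup.Build presented
  pres_mulA pres_mul1 pres_mulr1 pres_mulV pres_mulrV.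

Definition pres_gen (x : I) : presented := pres_class [:: (x, false)].

End PresentedGroup.

Lemma presented_countable (I : countType) (rels : seq (word I * word I)) :
  countable [set: presented rels].
Proof.
apply/countable_injP; exists (fun g => pickle (repr g)) => g h _ _ gh.
rewrite -(pres_reprK g) -(pres_reprK h).
by congr pres_class; apply: (pcan_inj pickleK).
Qed.

(* The element of G represented by a word, the letters being sent to gens.    *)
Definition word_val (I : Type) (G : groupType) (gens : I -> G) (w : word I) :
    G :=
  (\prod_(p <- w) (if p.2 then (gens p.1)^-1 else gens p.1))%g.

Lemma word_val_inv (I : Type) (G : groupType) (gens : I -> G) (w : word I) :
  word_val gens (inv_word w) = ((word_val gens w)^-1)%g.
Proof.
rewrite /word_val /inv_word -map_rev big_map -{2}(revK w) -prodgV.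
by apply: eq_bigr => -[x []] _ /=; rewrite ?invgK.
Qed.

Definition generates (I : Type) (G : groupType) (gens : I -> G) : Prop :=
  forall g, exists w, word_val gens w = g.

Lemma pres_word_val (I : choiceType) (rels : seq (word I * word I)) w :
  word_val (@pres_gen I rels) w = pres_class rels w.
Proof.
rewrite /word_val; elim: w => [|[x b] w IH]; first by rewrite big_nil.
rewrite big_cons IH -cat1s pres_class_cat; congr (_ * _)%g.
case: b => //=.
exact: (esym (pres_class_inv rels [:: (x, false)])).
Qed.

Lemma pres_generates (I : choiceType) (rels : seq (word I * word I)) :
  generates (@pres_gen I rels).
Proof. by move=> g; exists (repr g); rewrite pres_word_val pres_reprK. Qed.

Record length_function (R : realType) (G : groupType) := LengthFunction {
  length :> G -> R;
  length_ge0 : forall g, 0 <= length g;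
  length1 : length 1%g = 0;
  lengthV : forall g, length g^-1%g = length g;
  lengthM : forall g h, length (g * h)%g <= length g + length h }.

Section WordLength.
Variables (I : Type) (G : groupType) (gens : I -> G) (genG : generates gens).

Fact word_length_subproof (g : G) :
  exists n, `[< exists2 w, size w = n & word_val gens w = g >].
Proof. by have [w wg] := genG g; exists (size w); apply/asboolP; exists w. Qed.

Definition word_length (g : G) : nat := ex_minn (word_length_subproof g).

Lemma word_length_le w : (word_length (word_val gens w) <= size w)%N.
Proof.
by rewrite /word_length; case: ex_minnP => n _; apply; apply/asboolP; exists w.
Qed.

Lemma word_length_ex g :
  exists2 w, size w = word_length g & word_val gens w = g.
Proof. by rewrite /word_length; case: ex_minnP => n /asboolP. Qed.

Variable R : realType.

Fact word_length1 : (word_length 1%g)%:R = 0 :> R.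
Proof.
have := word_length_le [::]; rewrite /word_val big_nil leqn0 => /eqP ->.
by [].
Qed.

Fact word_lengthV g : (word_length g^-1%g)%:R = (word_length g)%:R :> R.
Proof.
have le h : (word_length h^-1%g <= word_length h)%N.
  have [w <- <-] := word_length_ex h; rewrite -word_val_inv.
  by rewrite (leq_trans (word_length_le _)) // size_rev size_map.
by apply/eqP; rewrite eqr_nat eqn_leq le -{1}[g]invgK le.
Qed.

Fact word_lengthM g h :
  (word_length (g * h)%g)%:R <= (word_length g)%:R + (word_length h)%:R :> R.
Proof.
rewrite -natrD ler_nat; have [u <- <-] := word_length_ex g.
have [v <- <-] := word_length_ex h; rewrite -size_cat /word_val -big_cat.
exact: word_length_le.
Qed.

Definition word_length_function : length_function R G :=
  @LengthFunction R G (fun g => (word_length g)%:R)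
    (fun g => ler0n _ _) word_length1 word_lengthV word_lengthM.

End WordLength.

Definition card_le_real (R : realType) (T : Type) (A : set T) (x : R) : Prop :=
  exists2 n : nat, (A #= `I_n)%card & n%:R <= x.

Section Branching.
Variables (R : realType) (G : groupType) (l : length_function R G).
Local Open Scope group_scope.

(* A 3-path is the triple (a3, a2, a1), in this order. *)
Definition path3 (z : G) : set (G * G * G) :=
  [set p | z = p.1.1 * p.1.2 * p.2].

Definition geodesic3 (kappa delta : R) : set (G * G * G) :=
  [set p | (l p.2 + l p.1.2 + l p.1.1 <=
            kappa * l (p.1.1 * p.1.2 * p.2)%g + delta)%R].

Definition triangle : set (G * G * G) := [set t | t.1.2 * t.1.1 = t.2].

(* Only the values C r z with 0 <= r are meaningful. *)
Definition path_family := R -> G -> set (G * G * G).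

Definition family_poly_growth (C : path_family) : Prop :=
  exists p : {poly R}, forall (r : R) (z : G), (0 <= r)%R ->
    card_le_real (C r z) p.[r]%R.

Definition retract_fiber (C : path_family) (r : R) (t : G * G * G) :
    set (G * G * G) :=
  let: (u, v, w) := t in
  [set d | let: (a, b, c) := d in
    [/\ C r (b^-1 * u * a) (b^-1, u, a),
        C r (c^-1 * v * b) (c^-1, v, b) &
        C r (c^-1 * w * a) (c^-1, w, a)]].

(* s' is a retract of s along C. *)
Definition retract_along (C : path_family) (s' s : set (G * G * G)) : Prop :=
  exists p : {poly R}, forall x y z, s (x, y, z) ->
    exists u v w a b c,
      [/\ s' (u, v, w), (l u <= p.[l x])%R,
          retract_fiber C (l x) (u, v, w) (a, b, c),
          b^-1 * u * a = x & c^-1 * w * a = z].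

Definition triangles_poly_growth (s : set (G * G * G)) : Prop :=
  exists p : {poly R}, forall (z : G) (r : R), (0 <= r)%R ->
    card_le_real [set t | [/\ s t, t.2 = z & (l t.1.1 <= r)%R]] p.[r]%R.

Definition polynomial_branching : Prop :=
  exists (kappa delta : R) (C : path_family) (s : set (G * G * G)),
    [/\ (1 <= kappa)%R /\ (0 <= delta)%R,
        forall r z, (0 <= r)%R -> C r z `<=` path3 z `&` geodesic3 kappa delta,
        family_poly_growth C,
        s `<=` triangle /\ retract_along C s triangle &
        triangles_poly_growth s].

End Branching.

Inductive wise_letter := La | Lb | Lc | Ls | Lt.

Definition wise_letter_code (x : wise_letter) : nat :=
  match x with La => 0 | Lb => 1 | Lc => 2 | Ls => 3 | Lt => 4 end.

Definition wise_letter_decode (n : nat) : wise_letter :=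
  nth La [:: La; Lb; Lc; Ls; Lt] n.

Fact wise_letter_codeK : cancel wise_letter_code wise_letter_decode.
Proof. by case. Qed.

HB.instance Definition _ := Countable.copy wise_letter
  (can_type wise_letter_codeK).

(* c = ab = ba and c^2 = s a s^-1 = t b t^-1. *)
Definition wise_rels : seq (word wise_letter * word wise_letter) :=
  let a := (La, false) in let b := (Lb, false) in let c := (Lc, false) in
  let s := (Ls, false) in let t := (Lt, false) in
  let s' := (Ls, true) in let t' := (Lt, true) in
  [:: ([:: c], [:: a; b]);
      ([:: a; b], [:: b; a]);
      ([:: c; c], [:: s; a; s']);
      ([:: s; a; s'], [:: t; b; t'])].

Definition wise_group : groupType := presented wise_rels.

Definition wise_length (R : realType) : length_function R wise_group :=
  word_length_function (@pres_generates _ wise_rels) R.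

(* Main.v *)
Require Import Defs.
From mathcomp Require Import all_boot all_order all_algebra.
From mathcomp Require Import all_classical reals.
From mathcomp Require Import zify lra.

(** G acts on the Bass-Serre tree of its presentation as a double HNN extension
    of A = <a, b>; the vertices are the cosets p A and the edges are labelled by
    s and t.  For a triangle with corners g1, g2, g3, let p A be the centre of
    the tripod spanned in the tree: every word leading from one corner to
    another meets p A.  Replacing each corner by a nearest point of p A yields a
    triangle with sides in A, and the detours through these points are at most
    3 times as long as the geodesics.  Growth is then polynomial because A is
    undistorted (a norm on Z^2 giving a, b and c^2 the same length is preserved
    along the edges), because only n + 1 vertices of a tree path lie at distance
    at most n from its origin, and because the last point of a 3-path is
    determined by the coset p A and the end of the path. *)

Set Implicit Arguments.
Unset Strict Implicit.
Unset Printing Implicit Defensive.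

Import Order.TTheory GRing.Theory Num.Theory.

Local Open Scope classical_set_scope.
Local Open Scope ring_scope.

Lemma card_le_real_inj (R : realType) (T U : Type) (A : set T) (B : set U)
    (f : T -> U) (x : R) :
  set_inj A f -> (forall t, A t -> B (f t)) ->
  card_le_real B x -> card_le_real A x.
Proof.
move=> fI fAB [n Bn nx].
have AB : (A #<= B)%card.
  rewrite -(card_le_eql (inj_card_eq fI)).
  by apply: subset_card_le => _ [t At <-]; apply: fAB.
have An : (A #<= `I_n)%card by rewrite -(card_le_eqr Bn).
have /finite_setP[k Ak] : finite_set A by apply/finite_set_leP; exists n.
exists k => //; apply: le_trans nx; rewrite ler_nat -card_le_II.
by rewrite -(card_le_eql Ak).
Qed.

Lemma card_le_real_fin (R : realType) (T : Type) (F : finType) (A : set T)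
    (f : T -> F) (x : R) :
  set_inj A f -> #|F|%:R <= x -> card_le_real A x.
Proof.
move=> fI Fx; apply: (@card_le_real_inj R _ _ _ `I_#|F| (enum_rank \o f)).
- by move=> t u At Au /= /ord_inj/enum_rank_inj; apply: fI.
- by move=> t _; apply: ltn_ord.
- by exists #|F|; rewrite // card_eqxx.
Qed.

(** * Branching along separating cosets *)

Section Separation.
Variables (I : Type) (G : groupType) (gens : I -> G) (genG : generates gens).
Variable A : set G.
Local Open Scope group_scope.

(** A word is a path in the Cayley graph starting at [g], and its prefixes give the points visited;
    [p A] may be met at an endpoint. *)
Definition separates (g p h : G) : Prop :=
  forall w : word I, g * word_val gens w = h ->
  exists w1 w2, w = w1 ++ w2 /\ A (p^-1 * (g * word_val gens w1)).

Hypothesis A1 : A 1.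
Hypothesis AM : forall g h, A g -> A h -> A (g * h).
Hypothesis AV : forall g, A g -> A g^-1.

Lemma separates_translate k g p h :
  separates g p h -> separates (k * g) (k * p) (k * h).
Proof.
move=> sep w; rewrite -mulgA => /mulgI/sep[w1 [w2 [-> Aw]]].
by exists w1, w2; split; rewrite // invgM -!mulgA mulKg.
Qed.

Lemma separates_coset g p q h :
  A (p^-1 * q) -> separates g p h -> separates g q h.
Proof.
move=> Apq sep w /sep[w1 [w2 [-> Aw]]]; exists w1, w2; split=> //.
by have := AM (AV Apq) Aw; rewrite invgM invgK -!mulgA mulVKg.
Qed.


Variable R : realType.
Local Notation l := (word_length_function genG R).

(** A geodesic word from [g] to [h] is cut where it meets [p A]. *)
Lemma separates_length g p h : separates g p h ->
  exists2 q, A (p^-1 * q) &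
    (l (g^-1 * q)%g + l (q^-1 * h)%g <= l (g^-1 * h)%g)%R.
Proof.
move=> sep; have [w lw wgh] := word_length_ex genG (g^-1 * h).
have [|w1 [w2 [ww Aw]]] := sep w; first by rewrite wgh mulVKg.
exists (g * word_val gens w1) => //; rewrite mulKg.
have -> : (g * word_val gens w1)^-1 * h = word_val gens w2.
  rewrite -[h](mulVKg g) -wgh ww [word_val _ (_ ++ _)]big_cat -/(word_val _ _).
  by rewrite [g * (_ * _)]mulgA mulKg.
rewrite /= -natrD ler_nat -lw ww size_cat.
by rewrite leq_add // word_length_le.
Qed.

(** A choice depending on [S] alone, so that equal cosets get the same representative; the default
    [1] is taken only for empty [S]. *)
Definition shortest (S : set G) : G :=
  xget 1 [set h | S h /\ forall k, S k -> (l h <= l k)%R].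

Lemma shortestP (S : set G) k : S k ->
  S (shortest S) /\ (l (shortest S)%g <= l k)%R.
Proof.
move=> Sk; rewrite /shortest; case: xgetP => [h _ [Sh lh]|noS].
  by split=> //; apply: lh.
exfalso.
have ex : exists n, `[< exists2 h, S h & word_length genG h = n >].
  by exists (word_length genG k); apply/asboolP; exists k.
have [n /asboolP[h Sh <-] nmin] := ex_minnP ex.
apply: (noS h); split=> // j Sj; rewrite /= ler_nat nmin //.
by apply/asboolP; exists j.
Qed.

Definition remainder (g : G) : G := shortest [set h | A (h / g)].

Lemma remainder_mull u g : A u -> remainder (u * g) = remainder g.
Proof.
move=> Au; congr shortest; apply/seteqP; split=> h /=.
  by move=> Ah; have := AM Ah Au; rewrite invgM mulgA mulgVK.
by move=> Ah; rewrite invgM mulgA; apply/AM/AV.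
Qed.

Lemma remainderP g : A (remainder g / g).
Proof. by have [] := @shortestP [set h | A (h / g)] g _; rewrite /= ?mulgV. Qed.

Lemma remainder_min g h : A (h / g) -> (l (remainder g)%g <= l h)%R.
Proof. by move=> Ah; have [] := shortestP (S := [set h | A (h / g)]) Ah. Qed.

(* [g * (remainder (p^-1 * g))^-1] is a nearest point of [p A] to [g]; going *)
(* through nearest points at most triples the length of a path meeting [p A]. *)
Lemma separates_remainder g p h : separates g p h ->
  let a := remainder (p^-1 * g) in
  let b := remainder (p^-1 * h) in
  [/\ l a <= l (h^-1 * g)%g, l b <= l (h^-1 * g)%g,
      l (b * (h^-1 * g) / a)%g <= 3 * l (h^-1 * g)%g &
      l a + l (b * (h^-1 * g) / a)%g + l b <= 3 * l (h^-1 * g)%g]%R.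
Proof.
move=> sep a b; have [q Aq lq] := separates_length sep.
have minq k : (l (remainder (p^-1 * k))%g <= l (q^-1 * k)%g)%R.
  apply: remainder_min; rewrite invgM mulgA mulgK.
  by have := AV Aq; rewrite invgM invgK.
have hg : (l (h^-1 * g)%g = l (g^-1 * h)%g)%R by rewrite -lengthV invgM invgK.
have [ag bh] := (minq g, minq h); rewrite -/a -/b in ag bh.
have gq : (l (g^-1 * q)%g = l (q^-1 * g)%g)%R by rewrite -lengthV invgM invgK.
(* The middle piece is routed through [q]. As [a] and [b] are no longer than the distances to [q],
   it is at most twice the whole length, and [l a + l b] adds it at most once more: hence the factor
   3. *)
have tri : (l (b * (h^-1 * g) / a)%g <=
            l b + l (q^-1 * h)%g + (l (q^-1 * g)%g + l a))%R.
  have -> : b * (h^-1 * g) / a = (b * (q^-1 * h)^-1) * ((q^-1 * g) / a).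
    by rewrite !gnorm.
  apply: le_trans (lengthM _ _ _) _.
  apply: lerD; apply: le_trans (lengthM _ _ _) _.
    by rewrite lengthV.
  by rewrite lengthV.
have := length_ge0 l (q^-1 * h)%g; have := length_ge0 l (q^-1 * g)%g.
rewrite hg; move: tri ag bh lq; rewrite gq.
by move=> *; split; lra.
Qed.

(** The corners are translated to [1] and [z^-1], and [t.2^-1] represents the separating coset. The
    last condition makes [t.1.1], hence the whole path, a function of [t.2] and [z], so that
    counting paths amounts to counting separating points. *)
Definition branching_paths : path_family R G := fun r z =>
  [set t | [/\ t.1.1 * t.1.2 * t.2 = z, geodesic3 l 3 0 t, (l t.2 <= r)%R,
               separates 1 t.2^-1 z^-1 & t.1.1^-1 = remainder (t.2 / z)]].

Lemma branching_paths_remainder r g p h : separates g p h ->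
  let a := remainder (p^-1 * g) in
  let b := remainder (p^-1 * h) in
  (l a <= r)%R ->
  branching_paths r (h^-1 * g) (b^-1, b * (h^-1 * g) / a, a).
Proof.
move=> sep a b lar.
have pathE : b^-1 * (b * (h^-1 * g) / a) * a = h^-1 * g.
  by rewrite !mulgA mulgVK mulVg mul1g.
split=> //.
- change (l a + l (b * (h^-1 * g) / a)%g + l b^-1%g <=
    3 * l (b^-1 * (b * (h^-1 * g) / a) * a)%g + 0)%R.
  by rewrite pathE lengthV addr0; have [_ _ _] := separates_remainder sep.
- rewrite /= invgM invgK; have := separates_translate (k := g^-1) sep.
  rewrite mulVg; apply: separates_coset.
  by have := AV (remainderP (p^-1 * g)); rewrite -/a !gnorm.
(* Since [a] lies in the coset [A (p^-1 * g)], [p^-1 * h] may be replaced by [a * g^-1 * h]. *)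
- rewrite /b -(remainder_mull (p^-1 * h) (remainderP (p^-1 * g))) -/a.
  by rewrite /= !gnorm.
Qed.

(** The retract consists of the triangles with all sides in [A]. Centres of tripods give the
    retraction, the count of separating points bounds the 3-paths, and the growth of [A] bounds the
    triangles, since [u] and [w] determine [v]. *)
Theorem separating_cosets_branching :
  (forall g h, exists p,
     [/\ separates 1 p g, separates 1 p h & separates g p h]) ->
  (exists q : {poly R}, forall r g, (0 <= r)%R ->
     card_le_real [set p | (l p <= r)%R /\ separates 1 p g] q.[r]%R) ->
  (exists q : {poly R}, forall r, (0 <= r)%R ->
     card_le_real [set u | A u /\ (l u <= r)%R] q.[r]%R) ->
  polynomial_branching l.
Proof.
move=> center [q1 Hq1] [q2 Hq2].
exists 3%R, 0%R, branching_paths,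
  (triangle (G := G) `&` [set t | [/\ A t.1.1, A t.1.2 & A t.2]]).
split.
- by split; rewrite ?ler1n.
- by move=> r z _ t [tz tg _ _ _]; split.
- exists q1 => r z r0.
  apply: card_le_real_inj (Hq1 r z^-1 r0).
    instantiate (1 := fun t => t.2^-1).
    move=> [[a3 a2] a1] [[b3 b2] b1] /set_mem[/= az _ _ _ a3E].
    move=> /set_mem[/= bz _ _ _ b3E] /invg_inj ab; subst b1.
    have ab3 : a3 = b3 by apply: invg_inj; rewrite a3E b3E.
    by subst b3; move: az; rewrite -bz => /mulIg/mulgI ->.
  by move=> t [_ _ lt sep _]; split; rewrite // lengthV.
- split; first by move=> t [].
  exists (3%:P * 'X)%R => x y z; rewrite /triangle /= => yxz.
  (* With corners [1], [x^-1] and [z^-1], the sides [h^-1 * g] are [x], [y] and [z]. *)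
  have [p [p1x p1z pxz]] := center x^-1 z^-1.
  pose a := remainder (p^-1 * 1).
  pose b := remainder (p^-1 * x^-1).
  pose c := remainder (p^-1 * z^-1).
  have [la lb lu _] := separates_remainder p1x.
  rewrite -/a -/b -/c !invgK mulg1 in la lb lu.
  have Aabc g h : A (remainder (p^-1 * h) * (h^-1 * g) / remainder (p^-1 * g)).
    have := AM (remainderP (p^-1 * h)) (AV (remainderP (p^-1 * g))).
    by rewrite !gnorm.
  exists (b * x / a), (c * y / b), (c * z / a), a, b, c; split.
  + split=> /=; first by rewrite /triangle /= -yxz !gnorm.
    have := Aabc 1 x^-1; have := Aabc 1 z^-1; have := Aabc x^-1 z^-1.
    rewrite !invgK !mulg1 -/b -/c -[p^-1]mulg1 -/a.
    by rewrite -yxz !gnorm; split.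
  + by rewrite !hornerE.
  (* All three paths have index [l x]. Their last entries are [a], [b] and [a], of length at most
     [l x] because the coset separates [1] from [x^-1]; [c] occurs only in first entries, which
     [branching_paths] does not bound by [r]. *)
  + have yE : y = z / x by rewrite -yxz mulgK.
    have pE g h k : branching_paths (l x) k g -> k = h ->
      branching_paths (l x) h g by move=> + <-.
    split.
    * have := branching_paths_remainder p1x la.
      by rewrite -/a -/b invgK mulg1 => H; apply: pE H _; rewrite !gnorm.
    * have := branching_paths_remainder pxz lb; rewrite -/b -/c invgK -yE.
      by move=> H; apply: pE H _; rewrite !gnorm.
    * have := branching_paths_remainder p1z la.
      by rewrite -/a -/c invgK mulg1 => H; apply: pE H _; rewrite !gnorm.
  + by rewrite !gnorm.
  + by rewrite !gnorm.
- exists q2 => z r r0; apply: card_le_real_inj (Hq2 r r0).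
    instantiate (1 := fun t => t.1.1).
    move=> [[u v] w] [[u' v'] w'] /set_mem[/= [/= t1 _] wz _].
    move=> /set_mem[/= [/= t2 _] wz' _] uu'; subst.
    by move: t1 t2; rewrite /triangle /= => <- /mulIg ->.
  by move=> t [[_ [Au _ _]] _ lt].
Qed.
End Separation.

(** * Powers with integer exponents *)

Section IntegerPowers.
Variable G : groupType.
Local Open Scope group_scope.

Definition zpow (x : G) (i : int) : G :=
  match i with Posz n => x ^+ n | Negz n => x ^- n.+1 end.

Lemma zpowS x i : zpow x (i + 1)%R = zpow x i * x.
Proof.
case: i => [n|[|n]] /=.
- by rewrite addn1 expgSr.
- by rewrite mulVg.
- by rewrite subn1 [x ^+ n.+2]expgS invgM mulgVK.
Qed.

Lemma zpowB1 x i : zpow x (i - 1)%R = zpow x i / x.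
Proof. by rewrite -[in RHS](subrK 1 i)%R zpowS mulgK. Qed.

Lemma zpowD x i j : zpow x (i + j)%R = zpow x i * zpow x j.
Proof.
elim: j => [|n IH|n IH].
- by rewrite addr0 mulg1.
- by rewrite intS [(1 + _)%R]addrC addrA !zpowS IH mulgA.
- by rewrite intS opprD [(- 1 + _)%R]addrC addrA !zpowB1 IH mulgA.
Qed.

Lemma commute_zpow x y i : commute x y -> commute x (zpow y i).
Proof.
case: i => n xy; first exact: commuteX.
exact/commuteV/commuteX.
Qed.

End IntegerPowers.

(** * Normal forms *)

(* [(x, e)] stands for s or t according to [x], inverted if [e] holds.  In G, *)
(* [line t] times the letter [t] is [t] times [line (flip t)], so [line t]    *)
(* spans the stabilizer in A of the edge along [t].                           *)
Definition stable := (bool * bool)%type.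
Definition flip (t : stable) : stable := (t.1, ~~ t.2).
Definition line (t : stable) : int * int :=
  if t.2 then if t.1 then (0, 1) else (1, 0) else (2, 2).
(** Coefficient along [line t] for a transversal of that line in A: vectors with one coordinate
    zero, or with first coordinate 0 or 1 when the line is that of c^2. *)
Definition quo (t : stable) (h : int * int) : int :=
  if t.2 then if t.1 then h.2 else h.1 else (h.1 %/ 2)%Z.
Definition residue (t : stable) (h : int * int) : int * int :=
  h - line t *~ quo t h.

Lemma flipK : involutive flip.
Proof. by move=> [x []]. Qed.

Lemma mulrz_pair (v : int * int) k : v *~ k = (v.1 * k, v.2 * k).
Proof.
have nat_pair n : v *+ n = (v.1 *+ n, v.2 *+ n).
  by elim: n => [|n IH]; rewrite ?mulr0n // !mulrS IH.
rewrite -!mulrzz; case: k => n; first exact: nat_pair.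
by rewrite !NegzE !mulrNz -!pmulrn nat_pair.
Qed.

Lemma quoD t h k : quo t (h + line t *~ k) = quo t h + k.
Proof.
rewrite mulrz_pair /quo /line; case: t => [[] []] /=; lia.
Qed.

Lemma quo0 t : quo t 0 = 0.
Proof. by case: t => [[] []]. Qed.

Lemma quo_line t k : quo t (line t *~ k) = k.
Proof. by rewrite -[line t *~ k]add0r quoD quo0 add0r. Qed.

Lemma residue_line t k : residue t (line t *~ k) = 0.
Proof. by rewrite /residue quo_line subrr. Qed.

Lemma residueD t h k : residue t (h + line t *~ k) = residue t h.
Proof. by rewrite /residue quoD mulrzDr opprD addrACA subrr addr0. Qed.

Lemma quo_residue t h : quo t (residue t h) = 0.
Proof. by rewrite /residue -mulrNz quoD subrr. Qed.

Lemma residueK t h : residue t h + line t *~ quo t h = h.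
Proof. by rewrite /residue subrK. Qed.

Lemma residue_id t h : quo t h = 0 -> residue t h = h.
Proof. by rewrite /residue => ->; rewrite mulr0z subr0. Qed.

(* The state [([:: (rn, tn); ...; (r1, t1)], h)] stands for the element       *)
(* r1 t1 ... rn tn h; words act on states by right multiplication.            *)
Definition stack := seq ((int * int) * stable).
Definition state := (stack * (int * int))%type.

(** A zero vector between a letter and its inverse, that is, a backtracking of the tree path. The
    reduced stacks are the normal forms of the HNN extension. *)
Definition blocked (L : stack) (r : int * int) (t : stable) : bool :=
  if L is (_, t') :: _ then (t' == flip t) && (r == 0) else false.

Fixpoint reduced (L : stack) : bool :=
  if L is (r, t) :: L' then
    [&& quo t r == 0, ~~ blocked L' r t & reduced L'] else true.

Definition shift (st : state) (v : int * int) : state := (st.1, st.2 + v).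

(** Right multiplication by [t]: the residue stays before [t], while the multiple of [line t] passes
    through and becomes one of [line (flip t)]. The inner [else st] is never reached, a blocked
    stack being nonempty. *)
Definition cross (st : state) (t : stable) : state :=
  let k := quo t st.2 in
  if blocked st.1 (residue t st.2) t then
    if st.1 is (r, t') :: L then (L, r + line t' *~ k) else st
  else ((residue t st.2, t) :: st.1, line (flip t) *~ k).

Lemma shiftA st v w : shift (shift st v) w = shift st (v + w).
Proof. by rewrite /shift addrA. Qed.

Lemma shift0 st : shift st 0 = st.
Proof. by case: st => L h; rewrite /shift addr0. Qed.

Lemma cross_push L h t : ~~ blocked L (residue t h) t ->
  cross (L, h) t = ((residue t h, t) :: L, line (flip t) *~ quo t h).
Proof. by move=> /negbTE nb; rewrite /cross nb. Qed.

Lemma cross_pop r L t k :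
  cross ((r, flip t) :: L, line t *~ k) t = (L, r + line (flip t) *~ k).
Proof. by rewrite /cross /= residue_line !eqxx quo_line. Qed.

Variant cross_spec (st : state) (t : stable) : state -> Type :=
| CrossPush : ~~ blocked st.1 (residue t st.2) t ->
    cross_spec st t ((residue t st.2, t) :: st.1, line (flip t) *~ quo t st.2)
| CrossPop r L k : st = ((r, flip t) :: L, line t *~ k) ->
    cross_spec st t (L, r + line (flip t) *~ k).

Lemma crossP st t : cross_spec st t (cross st t).
Proof.
have [bl|nb] := boolP (blocked st.1 (residue t st.2) t); last first.
  by case: st nb => L h nb; rewrite cross_push //; constructor.
case: st bl => [[|[r t'] L] h] //= /andP[/eqP -> /eqP rh].
rewrite -(residueK t h) rh add0r cross_pop; exact: CrossPop.
Qed.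

Lemma cross_reduced st t : reduced st.1 -> reduced (cross st t).1.
Proof.
case: crossP => [nb Lr|r L k ->] /=; first by rewrite quo_residue eqxx nb.
by case/and3P.
Qed.

(** A pop undoes a push. Conversely a popped entry is pushed back unchanged, since reducedness makes
    [r] its own residue and not blocked. *)
Lemma cross_flip st t : reduced st.1 -> cross (cross st t) (flip t) = st.
Proof.
case: (crossP st t) => [_ _|r L k -> /= /and3P[/eqP q0 nb _]].
  by have := cross_pop (residue t st.2) st.1 (flip t) (quo t st.2);
    rewrite flipK residueK => ->; case: st.
have rE : residue (flip t) (r + line (flip t) *~ k) = r.
  by rewrite residueD residue_id.
by rewrite cross_push rE // flipK quoD q0 add0r.
Qed.

Lemma cross_shift st t k :
  cross (shift st (line t *~ k)) t = shift (cross st t) (line (flip t) *~ k).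
Proof.
case: (crossP st t) => [nb|r L k' ->]; last first.
  by rewrite /shift /= -mulrzDr cross_pop mulrzDr addrA.
by rewrite cross_push /= residueD // quoD mulrzDr.
Qed.

(** * The action of words on states *)

Definition letter_stable (x : wise_letter) : option bool :=
  match x with Ls => Some false | Lt => Some true | _ => None end.

Definition letter_vec (x : wise_letter) : int * int :=
  match x with La => (1, 0) | Lb => (0, 1) | Lc => (1, 1) | _ => 0 end.

Definition step (st : state) (p : wise_letter * bool) : state :=
  if letter_stable p.1 is Some x then cross st (x, p.2)
  else shift st (if p.2 then - letter_vec p.1 else letter_vec p.1).

Definition run : state -> word wise_letter -> state := foldl step.

Lemma step_reduced st p : reduced st.1 -> reduced (step st p).1.
Proof. by rewrite /step; case: letter_stable => // x; apply: cross_reduced. Qed.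

Lemma run_reduced st w : reduced st.1 -> reduced (run st w).1.
Proof. by elim: w st => //= p w IH st /(step_reduced p)/IH. Qed.

Lemma run_cat st u v : run st (u ++ v) = run (run st u) v.
Proof. exact: foldl_cat. Qed.

Lemma cross_conj st t : reduced st.1 ->
  cross (shift (cross st t) (line (flip t))) (flip t) = shift st (line t).
Proof.
by move=> Lr; rewrite -[line (flip t)]mulr1z -cross_shift cross_flip.
Qed.

(** Van der Waerden's trick: the defining relations hold for the action on reduced states, so the
    action descends to G. *)
Lemma run_pres_eq u v : pres_eq wise_rels u v ->
  forall st, reduced st.1 -> run st u = run st v.
Proof.
elim=> {u v} //.
- by move=> u v _ IH st Lr; rewrite IH.
- by move=> u v w _ IH1 _ IH2 st Lr; rewrite IH1 // IH2.
- move=> u u' v v' _ IH1 _ IH2 st Lr.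
  by rewrite !run_cat IH1 // IH2 //; apply: run_reduced.
- move=> x b st Lr; rewrite /run /= /step /=.
  case: letter_stable => [y|]; first exact: cross_flip.
  by rewrite shiftA; case: b; rewrite /= ?addNr ?subrr shift0.
- move=> u v; rewrite !inE => uv st Lr.
  have conj_line x : run st [:: (if x then Lt else Ls, false);
    (if x then Lb else La, false); (if x then Lt else Ls, true)] =
    shift st (2, 2).
    by rewrite -(cross_conj (x, false) Lr); case: x.
  case/or4P: uv => /eqP[-> ->].
  + by rewrite /run /= /step /= !shiftA.
  + by rewrite /run /= /step /= !shiftA.
  + by rewrite (conj_line false) /run /= /step /= !shiftA.
  + by rewrite (conj_line false) (conj_line true).
Qed.

(** * Normal forms of group elements *)

Definition normal_form (g : wise_group) : state := run ([::], 0) (repr g).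

Lemma normal_form_mul g w :
  normal_form (g * word_val (@pres_gen _ wise_rels) w)%g =
  run (normal_form g) w.
Proof.
rewrite pres_word_val.
have -> : (g * pres_class wise_rels w)%g = pres_class wise_rels (repr g ++ w).
  by rewrite pres_class_cat pres_reprK.
rewrite -run_cat; exact: (run_pres_eq (pres_eq_repr _ _)).
Qed.

Lemma normal_form1 : normal_form 1%g = ([::], 0).
Proof. exact: (run_pres_eq (pres_eq_repr wise_rels [::])). Qed.

Lemma normal_form_reduced g : reduced (normal_form g).1.
Proof. exact: run_reduced. Qed.

Local Notation gen := (@pres_gen _ wise_rels).

(* Locked so that rewriting with [mulgA] does not see the product inside. *)
Fact flat_key : unit. Proof. by []. Qed.
Definition flat : int * int -> wise_group :=
  locked_with flat_key (fun v => zpow (gen La) v.1 * zpow (gen Lb) v.2)%g.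

Lemma flatE v : flat v = (zpow (gen La) v.1 * zpow (gen Lb) v.2)%g.
Proof. by rewrite /flat unlock. Qed.

Definition stable_elt (t : stable) : wise_group :=
  let g := gen (if t.1 then Lt else Ls) in if t.2 then g^-1%g else g.

Lemma wise_rel u v : (u, v) \in wise_rels -> word_val gen u = word_val gen v.
Proof. by move=> uv; rewrite !pres_word_val; apply/pres_classP/PresRel. Qed.

Lemma word_val_cons (I : Type) (G : groupType) (gens : I -> G) p w :
  word_val gens (p :: w) =
  ((if p.2 then (gens p.1)^-1 else gens p.1) * word_val gens w)%g.
Proof. exact: big_cons. Qed.

Lemma word_val_nil (I : Type) (G : groupType) (gens : I -> G) :
  word_val gens [::] = 1%g.
Proof. exact: big_nil. Qed.

Lemma wise_c : gen Lc = (gen La * gen Lb)%g.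
Proof.
have := @wise_rel [:: (Lc, false)] [:: (La, false); (Lb, false)] isT.
by rewrite !word_val_cons !word_val_nil !mulg1.
Qed.

Lemma wise_ab : commute (gen La) (gen Lb).
Proof.
have := @wise_rel [:: (La, false); (Lb, false)]
  [:: (Lb, false); (La, false)] isT.
by rewrite !word_val_cons !word_val_nil !mulg1.
Qed.

Lemma wise_s : (gen Lc * gen Lc)%g = (gen Ls * gen La / gen Ls)%g.
Proof.
have := @wise_rel [:: (Lc, false); (Lc, false)]
  [:: (Ls, false); (La, false); (Ls, true)] isT.
by rewrite !word_val_cons !word_val_nil !mulg1 mulgA.
Qed.

Lemma wise_t : (gen Lc * gen Lc)%g = (gen Lt * gen Lb / gen Lt)%g.
Proof.
have := @wise_rel [:: (Ls, false); (La, false); (Ls, true)]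
  [:: (Lt, false); (Lb, false); (Lt, true)] isT.
by rewrite !word_val_cons !word_val_nil !mulg1 !mulgA wise_s.
Qed.

Local Open Scope group_scope.

Lemma flatD v w : flat (v + w)%R = flat v * flat w.
Proof.
have ab i j : commute (zpow (gen La) i) (zpow (gen Lb) j).
  exact/commute_zpow/commute_sym/commute_zpow/commute_sym/wise_ab.
by rewrite !flatE !zpowD -!mulgA [zpow _ v.2 * (_ * _)]mulgA -ab !mulgA.
Qed.

Lemma flat0 : flat 0%R = 1.
Proof. by rewrite flatE mulg1. Qed.

Lemma flatN v : flat (- v)%R = (flat v)^-1.
Proof. by apply/esym/mulg1_eq; rewrite -flatD subrr flat0. Qed.

Lemma flat_letter x : letter_stable x = None -> flat (letter_vec x) = gen x.
Proof.
case: x => // _; rewrite !flatE /= ?expg1 ?expg0 ?mulg1 ?mul1g //.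
exact/esym/wise_c.
Qed.

Lemma flat_line t :
  flat (line t) * stable_elt t = stable_elt t * flat (line (flip t)).
Proof.
have c2 : flat (2, 2)%R = gen Lc * gen Lc.
  rewrite -(flat_letter (erefl : letter_stable Lc = None)) -flatD.
  by congr flat.
have a1 : flat (1, 0)%R = gen La by apply: (flat_letter (x := La)).
have b1 : flat (0, 1)%R = gen Lb by apply: (flat_letter (x := Lb)).
case: t => [[] []]; rewrite /line /stable_elt /= c2 ?a1 ?b1.
- by rewrite wise_t !gnorm.
- by rewrite wise_t !gnorm.
- by rewrite wise_s !gnorm.
- by rewrite wise_s !gnorm.
Qed.

Lemma flat_lineZ t k :
  flat (line t *~ k)%R * stable_elt t =
  stable_elt t * flat (line (flip t) *~ k)%R.
Proof.
elim: k => [|n IH|n IH].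
- by rewrite !mulr0z flat0 mulg1 mul1g.
- by rewrite intS !mulrzDr !mulr1z !flatD -mulgA IH !mulgA flat_line.
- rewrite intS opprD !mulrzDr !mulrN1z !flatD !flatN -mulgA IH !mulgA.
  congr (_ * _); apply: (mulgI (flat (line t))).
  by rewrite mulVKg mulgA flat_line mulgK.
Qed.

Fixpoint stack_elt (L : stack) : wise_group :=
  if L is (r, t) :: L' then stack_elt L' * flat r * stable_elt t else 1.

Definition state_elt (st : state) : wise_group := stack_elt st.1 * flat st.2.

Lemma state_elt_cross st t :
  state_elt (cross st t) = state_elt st * stable_elt t.
Proof.
rewrite /state_elt; case: (crossP st t) => [_|r L k ->] /=.
  by rewrite -!mulgA -flat_lineZ [flat _ * (_ * _)]mulgA -flatD residueK.
rewrite flatD -[RHS]mulgA flat_lineZ !mulgA; congr (_ * _).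
by rewrite -[LHS](mulgVK (stable_elt t)); case: t => [[] []];
  rewrite /stable_elt /= ?invgK ?mulgVK ?mulgK.
Qed.

Lemma state_elt_step st p : state_elt (step st p) =
  state_elt st * (if p.2 then (gen p.1)^-1 else gen p.1).
Proof.
case: p => x b; rewrite /step /=; case E : (letter_stable x) => [y|].
  by rewrite state_elt_cross /stable_elt; case: x y E => // -[].
rewrite /state_elt /= flatD mulgA; congr (_ * _).
by case: b; rewrite ?flatN flat_letter.
Qed.

Lemma state_elt_run st w : state_elt (run st w) = state_elt st * word_val gen w.
Proof.
elim: w st => [|p w IH] st; first by rewrite word_val_nil mulg1.
by rewrite IH state_elt_step word_val_cons mulgA.
Qed.

Lemma normal_formK g : state_elt (normal_form g) = g.
Proof.
rewrite state_elt_run pres_word_val pres_reprK /state_elt /= flat0.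
by rewrite !mul1g.
Qed.

Lemma normal_form_letter g p :
  normal_form (g * (if p.2 then (gen p.1)^-1 else gen p.1)) =
  step (normal_form g) p.
Proof.
have := normal_form_mul g [:: p].
by rewrite word_val_cons word_val_nil mulg1.
Qed.

Lemma normal_form_zpow g x i : letter_stable x = None ->
  normal_form (g * zpow (gen x) i) =
  shift (normal_form g) (letter_vec x *~ i)%R.
Proof.
move=> fx; have stepx b : step^~ (x, b) =
    shift^~ (if b then - letter_vec x else letter_vec x)%R.
  by apply/funext => st; rewrite /step /= fx.
elim: i => [|n IH|n IH].
- by rewrite mulg1 mulr0z shift0.
- rewrite intS [(1 + _)%R]addrC zpowS mulgA (normal_form_letter _ (x, false)).
  by rewrite (congr1 (@^~ _) (stepx false)) IH shiftA mulrzDr mulr1z.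
- rewrite intS opprD [(- 1 + _)%R]addrC zpowB1 mulgA.
  rewrite (normal_form_letter _ (x, true)) (congr1 (@^~ _) (stepx true)) IH.
  by rewrite shiftA mulrzDr mulrN1z.
Qed.

Lemma normal_form_flat g v : normal_form (g * flat v) = shift (normal_form g) v.
Proof.
rewrite !flatE mulgA !normal_form_zpow // shiftA; congr shift.
rewrite !mulrz_pair /=; case: v => i j; congr pair; rewrite /=; lia.
Qed.

Lemma normal_form_stable g t :
  normal_form (g * stable_elt t) = cross (normal_form g) t.
Proof.
case: t => x b; have := normal_form_letter g (if x then Lt else Ls, b).
by rewrite /step /=; case: x.
Qed.

(** Uniqueness of normal forms: read from the bottom of a reduced stack, each entry is its own
    residue and is not blocked, so it is pushed unchanged. *)
Lemma state_eltK st : reduced st.1 -> normal_form (state_elt st) = st.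
Proof.
case: st => L h /=; elim: L h => [|[r t] L IH] h /= red.
  by rewrite /state_elt mul1g -[flat h]mul1g normal_form_flat normal_form1
     /shift add0r.
case/and3P: red => /eqP q0 nb red.
rewrite /state_elt /= normal_form_flat normal_form_stable (IH r red).
by rewrite cross_push ?residue_id // q0 mulr0z /shift /= add0r.
Qed.

(** The vertex g A of the tree, encoded as the path leading to it from the root A. *)
Definition stack_of (g : wise_group) : stack := (normal_form g).1.

Lemma stack_ofP p g : range flat (p^-1 * g) <-> stack_of p = stack_of g.
Proof.
split=> [[v _ vE]|stackE].
  by rewrite -(mulVKg p g) -vE /stack_of normal_form_flat.
exists ((normal_form g).2 - (normal_form p).2)%R => //.
rewrite flatD flatN -{2}(normal_formK p) -{2}(normal_formK g) /state_elt.
rewrite -!/(stack_of _) stackE invgM -!mulgA mulKg.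
by rewrite -flatN -!flatD addrC.
Qed.

Lemma stack_of_word g w :
  stack_of (g * word_val gen w) = (run (normal_form g) w).1.
Proof. by rewrite /stack_of normal_form_mul. Qed.

Lemma stack_of_reduced g : reduced (stack_of g).
Proof. exact: normal_form_reduced. Qed.

(** * Centres of tripods *)

Lemma step_stack st p :
  [\/ (step st p).1 = st.1, exists e, (step st p).1 = e :: st.1
    | exists e, st.1 = e :: (step st p).1].
Proof.
rewrite /step; case: letter_stable => [x|]; last by constructor 1.
case: crossP => [_|r L k ->]; first by constructor 2; eexists.
by constructor 3; eexists.
Qed.

(* The entry of [L] just above its bottom part [M]; [None] if [L] is not a    *)
(* proper extension of [M].                                                   *)
Fixpoint branch (M L : stack) : option ((int * int) * stable) :=
  if L is e :: L' then if L' == M then Some e else branch M L' else None.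

(** Each letter adds or removes at most one entry, so the entry above [M] can change only by passing
    through [M] itself. *)
Lemma branch_run M st w :
  (forall w1 w2, w = w1 ++ w2 -> (run st w1).1 <> M) ->
  branch M (run st w).1 = branch M st.1.
Proof.
elim: w st => // p w IH st avoid; rewrite /= IH; last first.
  by move=> w1 w2 ww; apply: (avoid (p :: w1) w2); rewrite ww.
have stM : st.1 <> M by apply: (avoid [::] (p :: w)).
have stM' : (step st p).1 <> M by apply: (avoid [:: p] w).
case: (step_stack st p) => [-> //|[e ->] /=|[e stE]].
  by case: eqP.
by rewrite stE /=; case: eqP.
Qed.

Lemma branch_separates p g h :
  stack_of g = stack_of p \/ stack_of h = stack_of p \/
    branch (stack_of p) (stack_of g) <> branch (stack_of p) (stack_of h) ->
  separates gen (range flat) g p h.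
Proof.
move=> gh w hE; apply: contrapT => no.
have avoid w1 w2 : w = w1 ++ w2 -> (run (normal_form g) w1).1 <> stack_of p.
  move=> ww rp; apply: no; exists w1, w2; split=> //.
  by apply/stack_ofP; rewrite stack_of_word.
case: gh => [gp|[hp|]]; first exact: (avoid [::] w).
  by apply: (avoid w [::]); rewrite ?cats0 // -stack_of_word hE.
by apply; rewrite -hE stack_of_word (branch_run avoid).
Qed.

Lemma branch_nil L : L = [::] \/ branch [::] L <> None.
Proof.
elim: L => [|e L IH]; [by left|right] => /=.
by case: eqP => // LN; case: IH.
Qed.

Lemma branch_cons e M L : branch M L = Some e ->
  L = e :: M \/ branch (e :: M) L <> None.
Proof.
elim: L => //= f L IH; case: eqP => [-> [->]|_ /IH eL]; first by left.
by right; case: eqP => // LeM; case: eL.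
Qed.

(* [M] is the longest common bottom part of [K] and [L]. *)
Lemma branch_point (K L : stack) : exists M : stack,
  [/\ K = M \/ branch M K <> None, L = M \/ branch M L <> None &
      K = M \/ L = M \/ branch M K <> branch M L].
Proof.
elim: K => [|e K [M [KM LM KLM]]].
  by exists [::]; split; [left|apply: branch_nil|left].
have [KeqM|KneqM] := eqVneq K M.
  subst M; have [Le|Lne] := pselect (branch K L = Some e).
    by exists (e :: K); split; [left|apply: branch_cons|left].
  exists K; rewrite /= eqxx; split=> //; first by right.
  by right; right=> Le; apply: Lne.
exists M; rewrite /= (negbTE KneqM).
have KM' : branch M K <> None by case: KM => // /eqP; rewrite (negbTE KneqM).
split=> //; first by right.
by case: KLM => [/eqP|]; [rewrite (negbTE KneqM)|right].
Qed.

Lemma stack_of1 : stack_of 1 = [::].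
Proof. by rewrite /stack_of normal_form1. Qed.

(** One corner lies at the root, so the centre is the vertex where the tree paths from the root to
    [g] and to [h] part. *)
Lemma separating_center g h : exists p,
  [/\ separates gen (range flat) 1 p g, separates gen (range flat) 1 p h &
      separates gen (range flat) g p h].
Proof.
have [M [gM hM ghM]] := branch_point (stack_of g) (stack_of h).
have [p pM] : exists p, stack_of p = M.
  case: gM => [<-|gM]; first by exists g.
  (* A word spelling [g] must visit [M]: otherwise the branch at [M] would remain [None], its value
     at the root. *)
  have [w wg] := pres_generates g; apply: contrapT => no; apply: gM.
  rewrite -wg -[word_val _ _]mul1g stack_of_word branch_run ?normal_form1 //.
  move=> w1 w2 _ wM; apply: no; exists (1 * word_val gen w1).
  by rewrite stack_of_word normal_form1.
have from1 k : stack_of k = M \/ branch M (stack_of k) <> None ->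
    separates gen (range flat) 1 p k.
  move=> kM; apply: branch_separates; rewrite pM stack_of1; right.
  by case: kM => kM; [left|right; move/esym].
exists p; split; [exact: from1|exact: from1|apply: branch_separates].
by rewrite pM.
Qed.

(** * Words following tree geodesics *)

Lemma stack_of_flat_word g w :
  all (fun p => letter_stable p.1 == None) w ->
  stack_of (g * word_val gen w) = stack_of g.
Proof.
rewrite stack_of_word /stack_of; elim: w (normal_form g) => //= p w IH st.
by case/andP=> /eqP fp /IH ->; rewrite /step fp.
Qed.

Lemma word_val_cat (I : Type) (G : groupType) (gens : I -> G) u v :
  word_val gens (u ++ v) = word_val gens u * word_val gens v.
Proof. exact: big_cat. Qed.

Lemma zpow_word x i : letter_stable x = None ->
  exists2 w, word_val gen w = zpow (gen x) i &
    all (fun p => letter_stable p.1 == None) w.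
Proof.
move=> fx; have nseqE n b : word_val gen (nseq n (x, b)) =
    (if b then (gen x)^-1 else gen x) ^+ n.
  by elim: n => [|n IH]; rewrite ?word_val_nil //= word_val_cons IH expgS.
case: i => n.
  by exists (nseq n (x, false)); rewrite ?nseqE // all_nseq /= fx eqxx orbT.
exists (nseq n.+1 (x, true)); first by rewrite nseqE expVgn.
by rewrite all_nseq /= fx eqxx.
Qed.

Lemma flat_word v : exists2 w, word_val gen w = flat v &
  all (fun p => letter_stable p.1 == None) w.
Proof.
have [w1 w1E fw1] := @zpow_word La v.1 erefl.
have [w2 w2E fw2] := @zpow_word Lb v.2 erefl.
by exists (w1 ++ w2); rewrite ?all_cat ?fw1 // word_val_cat w1E w2E flatE.
Qed.

Lemma take_all (T : Type) (a : pred T) n s : all a s -> all a (take n s).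
Proof. by rewrite -{1}(cat_take_drop n s) all_cat => /andP[]. Qed.

(** The word spelled by the stack from the bottom up stays on the tree path to [L], because letters
    of A do not move the vertex. *)
Lemma geodesic_word L h : reduced L ->
  exists2 w, word_val gen w = state_elt (L, h) &
    forall n, suffix (stack_of (word_val gen (take n w))) L.
Proof.
elim: L h => [|[r t] L IH] h red.
  have [w wE fw] := flat_word h; exists w; first by rewrite wE /state_elt mul1g.
  move=> n; rewrite -[word_val _ _]mul1g stack_of_flat_word ?stack_of1 //.
  exact: take_all.
have [_ _ redL] := and3P red.
have [u uE Lu] := IH r redL; have [v vE fv] := flat_word h.
pose l : wise_letter * bool := (if t.1 then Lt else Ls, t.2).
have lE : word_val gen [:: l] = stable_elt t.
  by rewrite word_val_cons word_val_nil mulg1.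
exists (u ++ l :: v) => [|n].
  by rewrite -cat1s !word_val_cat uE lE vE /state_elt /= mulgA.
rewrite take_cat; case: ltnP => _.
  exact: suffix_trans (Lu n) (suffix_cons _ _).
case: (n - size u)%N => [|m] /=.
  rewrite cats0 -[u]take_size; exact: suffix_trans (Lu _) (suffix_cons _ _).
rewrite -cat1s catA word_val_cat stack_of_flat_word ?take_all //.
rewrite word_val_cat uE lE -[_ * _](_ : state_elt ((r, t) :: L, 0%R) = _).
  by rewrite /stack_of state_eltK // suffix_refl.
by rewrite /state_elt /= flat0 mulg1.
Qed.

(** Separation is tested on a word visiting only suffixes of the stack of [g]; hence there is at
    most one separating coset of each stack size. *)
Lemma separates_suffix p g : separates gen (range flat) 1 p g ->
  suffix (stack_of p) (stack_of g).
Proof.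
have [w wE wL] := geodesic_word (normal_form g).2 (stack_of_reduced g).
move=> sep.
have [|w1 [w2 [ww]]] := sep w.
  by rewrite mul1g wE -[RHS]normal_formK /stack_of; case: (normal_form g).
rewrite mul1g => /stack_ofP ->.
by have := wL (size w1); rewrite ww take_size_cat.
Qed.

(** * Growth of cosets *)

Local Notation len := (word_length (@pres_generates _ wise_rels)).

Lemma size_stack_of g : (size (stack_of g) <= len g)%N.
Proof.
have [w <- <-] := word_length_ex (@pres_generates _ wise_rels) g.
rewrite -[word_val _ _]mul1g stack_of_word normal_form1.
have le st : (size (run st w).1 <= size st.1 + size w)%N.
  elim: w st => [|p w IH] st /=; first by rewrite addn0.
  apply: leq_trans (IH _) _; rewrite addnS -addSn leq_add2r.
  by case: (step_stack st p) => [->|[e ->]|[e stE]]; rewrite ?stE /=; lia.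
exact: le.
Qed.

Local Open Scope ring_scope.

(* A norm giving the lines of a, b and c^2 the same scale, so that crossing a *)
(* stable letter preserves lengths along the line.                            *)
Definition vnorm (v : int * int) : nat :=
  (3 * absz (v.1 - v.2)%R + absz (v.1 + v.2)%R)%N.

Lemma vnormD v w : (vnorm (v + w)%R <= vnorm v + vnorm w)%N.
Proof. by case: v w => [i j] [k l]; rewrite /vnorm /=; lia. Qed.

Lemma vnormN v : vnorm (- v) = vnorm v.
Proof. by case: v => [i j]; rewrite /vnorm /=; lia. Qed.

Lemma vnorm_line t k : vnorm (line t *~ k) = (4 * absz k)%N.
Proof. by rewrite mulrz_pair; case: t => [[] []]; rewrite /vnorm /=; lia. Qed.

Lemma vnorm_coord v n : (vnorm v <= n)%N ->
  (absz v.1 <= n)%N /\ (absz v.2 <= n)%N.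
Proof. by case: v => [i j]; rewrite /vnorm /=; lia. Qed.

(* [reach L h n]: the point [(L, h)] is at distance at most [n] from the base *)
(* point when each flat carries [vnorm] and lines are glued isometrically.    *)
Fixpoint reach (L : stack) (h : int * int) (n : nat) : Prop :=
  if L is (r, t) :: L' then
    exists k m, reach L' (r + line t *~ k) m /\
      (m + vnorm (h - line (flip t) *~ k)%R <= n)%N
  else (vnorm h <= n)%N.

Lemma reach_add L h v n m : reach L h n -> (n + vnorm v <= m)%N ->
  reach L (h + v) m.
Proof.
case: L => [|[r t] L] /=.
  move=> hn; apply: leq_trans; apply: leq_trans (vnormD _ _) _.
  by rewrite leq_add2r.
move=> [k [p [rp pn]]] nm; exists k, p; split=> //.
rewrite addrAC; apply: leq_trans nm.
by apply: leq_trans (leq_add (leqnn p) (vnormD _ _)) _; rewrite addnA leq_add2r.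
Qed.

(** Crossing is free because [vnorm_line] gives both lines the same scale. A push records the
    crossing point; a pop trades the displacement from the recorded point for one of equal norm on
    the lower flat. *)
Lemma reach_cross st t n : reach st.1 st.2 n ->
  reach (cross st t).1 (cross st t).2 n.
Proof.
case: (crossP st t) => [_ hn|r L k -> /= [k' [m [rm mn]]]] /=.
  exists (quo t st.2), n; rewrite residueK subrr; split=> //.
  by rewrite -[0](mulr0z (line t)) vnorm_line addn0.
have -> : r + line (flip t) *~ k =
    (r + line (flip t) *~ k') + line (flip t) *~ (k - k').
  by rewrite -addrA -mulrzDr [k' + _]addrC subrK.
apply: reach_add rm _; rewrite vnorm_line.
by move: mn; rewrite flipK -mulrzBr vnorm_line.
Qed.

(** The letters a and b have norm 4, c has norm 2, and a stable letter costs nothing. *)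
Lemma reach_step st p n : reach st.1 st.2 n ->
  reach (step st p).1 (step st p).2 (n + 4).
Proof.
case: p => x b rn; rewrite /step /=; case E: letter_stable => [y|].
  rewrite -[(cross _ _).2]addr0; apply: reach_add (reach_cross (y, b) rn) _.
  by rewrite leq_add2l.
apply: reach_add rn _; rewrite leq_add2l /=.
by case: b; rewrite ?vnormN; case: x E.
Qed.

(** A is undistorted: a geodesic word for [flat v] ends at the empty stack, where [reach] bounds
    [vnorm] itself. *)
Lemma vnorm_le v : (vnorm v <= 4 * len (flat v))%N.
Proof.
have [w <- wE] := word_length_ex (@pres_generates _ wise_rels) (flat v).
have le st n : reach st.1 st.2 n ->
    reach (run st w).1 (run st w).2 (n + 4 * size w).
  elim: w {wE} st n => [|p w IH] st n /= rn; first by rewrite muln0 addn0.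
  by have := IH _ _ (reach_step p rn); rewrite mulnS addnA.
have := le ([::], 0) 0%N (leqnn _).
rewrite -normal_form1 -normal_form_mul mul1g wE -[flat v]mul1g normal_form_flat.
by rewrite normal_form1 /= add0r add0n.
Qed.

(** Coordinates between -m and m are shifted by [m] to land between 0 and 2m. *)
Definition box (m : nat) (v : int * int) : 'I_(2 * m).+1 * 'I_(2 * m).+1 :=
  (inord (absz (v.1 + m%:Z)), inord (absz (v.2 + m%:Z))).

Lemma box_inj m v w : (vnorm v <= m)%N -> (vnorm w <= m)%N ->
  box m v = box m w -> v = w.
Proof.
move=> /vnorm_coord[v1 v2] /vnorm_coord[w1 w2].
rewrite /box => -[/(congr1 val)/= + /(congr1 val)/=].
rewrite !inordK; try lia.
by case: v w v1 v2 w1 w2 => [i j] [k l] /=  *; congr pair; lia.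
Qed.

(** * Polynomial bounds *)

Section Counting.
Variable R : realType.
Local Notation l := (wise_length R).

Lemma wise_length_truncn g r : 0 <= r -> (l g <= r) = (len g <= Num.truncn r)%N.
Proof. by move=> r0; rewrite truncn_ge_nat. Qed.

Lemma flat_growth : exists q : {poly R}, forall r, (0 <= r)%R ->
  card_le_real [set u | range flat u /\ (l u <= r)%R] q.[r]%R.
Proof.
(* Length at most n gives norm at most 4n, and a box of that radius has side 8n + 1. *)
exists ((8%:P * 'X + 1) ^+ 2) => r r0; set n := Num.truncn r.
apply: (@card_le_real_fin _ _ _ _ (fun u => box (4 * n) (normal_form u).2)).
  have nfE v : normal_form (flat v) = ([::], v).
    by rewrite -[flat v]mul1g normal_form_flat normal_form1 /shift add0r.
  move=> _ _ /set_mem[[v _ <-] lv] /set_mem[[w _ <-] lw] /=; rewrite !nfE /=.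
  move: lv lw; rewrite !wise_length_truncn // -/n => lv lw.
  move=> vw; congr flat; apply: box_inj vw.
    by apply: leq_trans (vnorm_le v) _; rewrite leq_mul2l.
  by apply: leq_trans (vnorm_le w) _; rewrite leq_mul2l.
have nr : n%:R <= r by rewrite truncn_le.
have K8 : (2 * (4 * n)).+1%:R = 8%:R * n%:R + 1 :> R.
  by rewrite -natr1 mulnA natrM.
rewrite card_prod card_ord natrM K8 -expr2 horner_exp !hornerE.
by rewrite lerXn2r ?nnegrE ?addr_ge0 ?mulr_ge0 // lerD2r ler_wpM2l.
Qed.

(** A point is coded by the stack size of its coset, which identifies the coset, and by its position
    relative to a base point there. *)
Lemma separating_growth : exists q : {poly R}, forall r g, (0 <= r)%R ->
  card_le_real [set p | (l p <= r)%R /\ separates gen (range flat) 1%g p g]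
    q.[r]%R.
Proof.
(* There are n + 1 stack sizes. Two points of [B] in one coset differ by an element of A of length
   at most 2n, hence of norm at most 8n, and the box has side 16n + 1. *)
exists (('X + 1) * (16%:P * 'X + 1) ^+ 2) => r g r0; set n := Num.truncn r.
set B := [set p | _].
(* The default [1] is never taken for the stack size of a point of [B]. *)
pose base k := xget 1%g [set p | B p /\ size (stack_of p) = k].
pose height p := (normal_form p).2.
have BlE p : B p -> (len p <= n)%N by case=> + _; rewrite wise_length_truncn.
have baseP p : B p -> let q := base (size (stack_of p)) in
    stack_of q = stack_of p /\ (vnorm (height p - height q)%R <= 8 * n)%N.
  move=> Bp q; have [Bq sq] : B q /\ size (stack_of q) = size (stack_of p).
    have ex : exists p', [set p' | B p' /\ size (stack_of p') =
        size (stack_of p)] p' by exists p.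
    exact: (xgetPex 1%g ex).
  have qp : stack_of q = stack_of p.
    have [_ /separates_suffix] := Bp; have [_ /separates_suffix] := Bq.
    by rewrite !suffixE sq => /eqP <- /eqP.
  split=> //; apply: leq_trans (vnorm_le _) _.
  have -> : flat (height p - height q) = (q^-1 * p)%g.
    have pE := normal_formK p; have qE := normal_formK q.
    rewrite -{2}pE -{2}qE /state_elt -/(stack_of p) -/(stack_of q) qp.
    by rewrite invgM -mulgA mulKg -flatN -flatD addrC.
  have := word_lengthM (@pres_generates _ wise_rels) R q^-1%g p.
  rewrite word_lengthV -natrD ler_nat => lqp.
  rewrite -[8%N]/(4 * 2)%N -mulnA leq_mul2l /= (leq_trans lqp) // mul2n -addnn.
  by rewrite leq_add // BlE.
apply: (@card_le_real_fin _ _ _ _ (fun p =>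
  let k := size (stack_of p) in
  (inord k : 'I_n.+1, box (8 * n) (height p - height (base k))))).
  have szB p : B p -> (size (stack_of p) < n.+1)%N.
    by move=> Bp; rewrite ltnS (leq_trans (size_stack_of p)) ?BlE.
  move=> p q /set_mem Bp /set_mem Bq pq.
  have kE : size (stack_of p) = size (stack_of q).
    by have /(congr1 val) := congr1 fst pq; rewrite /= !inordK ?szB.
  have [sp np] := baseP _ Bp; have [sq nq] := baseP _ Bq.
  have := congr1 snd pq; rewrite /= kE in sp np *.
  move=> /(box_inj np nq)/addIr hpq.
  rewrite -(normal_formK p) -(normal_formK q) /state_elt -!/(stack_of _).
  by rewrite -!/(height _) hpq -sp sq.
have nr : n%:R <= r by rewrite truncn_le.
have K16 : (2 * (8 * n)).+1%:R = 16%:R * n%:R + 1 :> R.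
  by rewrite -natr1 mulnA natrM.
rewrite !card_prod !card_ord !natrM K16 -natr1 -expr2 hornerM horner_exp.
rewrite !hornerD hornerM !hornerX !hornerC.
apply: ler_pM; rewrite ?exprn_ge0 ?addr_ge0 ?mulr_ge0 ?lerD2r //.
by rewrite lerXn2r ?nnegrE ?addr_ge0 ?mulr_ge0 // lerD2r ler_wpM2l.
Qed.

End Counting.

Theorem mainTheorem3 (R : realType) :
  polynomial_branching (wise_length R).
Proof.
apply: (@separating_cosets_branching _ _ _ _ (range flat)).
- by exists 0; rewrite ?flat0.
- by move=> _ _ [v _ <-] [w _ <-]; exists (v + w); rewrite ?flatD.
- by move=> _ [v _ <-]; exists (- v); rewrite ?flatN.
- exact: separating_center.
- exact: separating_growth.
- exact: flat_growth.
Qed.
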